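(* If the cardinality of a discrete space $X$ is strongly compact, then $X$ admits a functorial $|X|$-Lindelöfification.
   Context: All topological spaces are assumed to be completely regular and Hausdorff, and $|X|$ denotes the cardinality of $X$. For a cardinal $\kappa$, a space $X$ is $\kappa$-Lindelöf if for every open covering $\mathcal{U}$ of $X$ there is a subset $\mathcal{V}\subset\mathcal{U}$ with $\bigcup\mathcal{V}=X$ and $|\mathcal{V}|<\kappa$. A space $X$ admits a functorial $\kappa$-Lindelöfification if there exist a $\kappa$-Lindelöf space $\nu X$ and a continuous map $i_X:X\to\nu X$ such that for every $\kappa$-Lindelöf space $Y$ and every continuous map $f:X\to Y$ there is a unique continuous map $\tilde f:\nu X\to Y$ with $f=\tilde f\circ i_X$. A filter $U$ on a set is $\kappa$-complete if $\bigcap U_0\in U$ for every family $U_0\subset U$ with $|U_0|<\kappa$. A cardinal $\kappa$ is strongly compact if for any set $S$, every $\kappa$-complete filter over $S$ can be extended to a $\kappa$-complete ultrafilter over $S$.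
   Formalization: The discrete space X is assumed infinite, as is usual for strongly compact cardinals; the stated definition also admits finite cardinals, for which the claim fails (for example |X| = 3, where 3-Lindelöf spaces have at most two points). *)

(* Defs.v *)
From HB Require Import structures.
From mathcomp Require Import all_boot all_order all_algebra.
From mathcomp Require Import all_classical all_reals all_analysis.

Set Implicit Arguments.
Unset Strict Implicit.
Unset Printing Implicit Defensive.

Local Open Scope classical_set_scope.
Local Open Scope card_scope.

(* A cardinal kappa is given by a type K with |K| = kappa. *)

Definition card_lt (T U : Type) (A : set T) (B : set U) : Prop :=
  A #<= B /\ ~ (B #<= A).

Definition tychonoff_space (T : topologicalType) : Prop :=
  completely_regular_space T /\ hausdorff_space T.

Definition card_lindelof (K : Type) (T : topologicalType) : Prop :=
  forall U : set (set T),
    (forall A, U A -> open A) -> \bigcup_(A in U) A = [set: T] ->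
    exists V : set (set T),
      [/\ V `<=` U, \bigcup_(A in V) A = [set: T] & card_lt V [set: K]].

(* All spaces are Tychonoff by convention, hence the conditions on nuX and on
   the test spaces Y. *)
Definition has_functorial_lindelofification (K : Type) (X : topologicalType) :
    Prop :=
  exists (nuX : topologicalType) (i : X -> nuX),
    [/\ tychonoff_space nuX, card_lindelof K nuX, continuous i &
      forall (Y : topologicalType) (f : X -> Y),
        tychonoff_space Y -> card_lindelof K Y -> continuous f ->
        exists! g : nuX -> Y, continuous g /\ f = g \o i].

Definition card_complete (K S : Type) (F : set_system S) : Prop :=
  forall F0 : set (set S),
    F0 `<=` F -> card_lt F0 [set: K] -> F (\bigcap_(A in F0) A).

Definition strongly_compact (K : Type) : Prop :=
  forall (S : Type) (F : set_system S),
    ProperFilter F -> card_complete K F ->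
    exists G : set_system S,
      [/\ UltraFilter G, card_complete K G & F `<=` G].

(* Main.v *)
From HB Require Import structures.
Require Import Defs.
From mathcomp Require Import all_boot all_order all_algebra.
From mathcomp Require Import all_classical all_reals all_analysis.

Local Open Scope classical_set_scope.

(** Let kappa = |X|. The kappa-Lindelofification of the discrete space X is the
    space nu X ([kultra X X]) of the kappa-complete ultrafilters on X, with the
    topology generated by the clopen sets of the form
    [[set u | A \in u]] for A a subset of X; a point of X is sent to its
    principal ultrafilter.

    - nu X is zero-dimensional and Hausdorff, hence Tychonoff.
    - nu X is kappa-Lindelof ([kultra_lindelof]). Refine a cover to one by basic
      clopen sets. If fewer than kappa of them never cover X, then the
      complements of the corresponding subsets of X generate a proper
      kappa-complete filter; by strong compactness it lies in a kappa-complete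
      ultrafilter, which is a point of nu X outside every set of the cover.
    - A map f from X to a Tychonoff kappa-Lindelof space Y extends to nu X
      ([kultra_extension]) by sending u to the limit of the image ultrafilter
      f(u). The limit exists because Y is kappa-Lindelof and f(u) is
      kappa-complete, and it depends continuously on u because Y is regular.
      The extension is unique because the principal ultrafilters are dense.

    In the second point, the filter generated by a family with the
    kappa-intersection property is kappa-complete only if kappa is regular, that
    is, if a union of fewer than kappa sets of size less than kappa has size
    less than kappa. This has to be derived from strong compactness
    ([strongly_compact_regular]). If kappa were singular, a kappa-complete
    ultrafilter G would be closed under intersections of kappa sets. Let Z be
    the free magma over X, so that Z x Z embeds in Z. On the power set of Z, the
    complements of images of Z form the base of a kappa-complete filter, proper
    by Cantor's theorem; let G be a kappa-complete ultrafilter extending it. As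
    Z is obtained from X by countably many steps each indexed by X or by pairs
    of earlier elements, G is closed under Z-indexed intersections, hence
    decides every [z \in s] simultaneously and is principal. But G contains the
    complement of every singleton. *)

(** * Comparison of cardinals *)

Lemma card_le_of_rel {T U : Type} (A : set T) (B : set U) (R : T -> U -> Prop) :
    (forall a, A a -> exists2 b, B b & R a b) ->
    (forall a a' b, R a b -> R a' b -> a = a') ->
  (A #<= B)%card.
Proof.
move=> RAB Rinj; have [->|/set0P[a0 Aa0]] := eqVneq A set0.
  exact: card_ge0.
have [u0 _ _] := RAB _ Aa0.
have /choice[f fP] : forall a, exists b, A a -> B b /\ R a b.
  move=> a; have [/RAB[b Bb Rab]|nAa] := pselect (A a); first by exists b.
  by exists u0 => /nAa.
have /injfunPex[g] : exists2 f : T -> U, set_fun A B f & set_inj A f.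
  exists f; first by move=> a /fP[].
  move=> a a' /set_mem/fP[_ Ra] /set_mem/fP[_ Ra'] faa'.
  by apply: (Rinj _ _ (f a)) => //; rewrite faa'.
exact: inj_card_le.
Qed.

(** A partial injection from A to B that is maximal for inclusion of graphs must
    exhaust A or B. *)
Lemma card_le_total {T U : Type} (A : set T) (B : set U) :
  (A #<= B)%card \/ (B #<= A)%card.
Proof.
pose pinj (G : set (T * U)) := G `<=` A `*` B /\
  forall p q, G p -> G q -> (p.1 = q.1) <-> (p.2 = q.2).
have [F Fpinj Ftot|G [[GAB Ginj] Gmax]] := @Zorn_bigcup _ pinj.
  split=> [p [G /Fpinj[GAB _] /GAB]//|p q [G FG Gp] [H FH Hq]].
  have [GH|HG] := Ftot _ _ FG FH.
    by have [_] := Fpinj _ FH; apply => //; exact: GH.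
  by have [_] := Fpinj _ FG; apply => //; exact: HG.
have [domG|/existsNP[a /not_implyP[Aa aG]]] :=
    pselect (forall a, A a -> exists b, G (a, b)).
  left; apply: (@card_le_of_rel _ _ A B (fun a b => G (a, b))).
    by move=> a /domG[b Gab]; exists b => //; have [] := GAB _ Gab.
  by move=> a a' b Gab Gab'; exact: (Ginj _ _ Gab Gab').2.
have [ranG|/existsNP[b /not_implyP[Bb bG]]] :=
    pselect (forall b, B b -> exists a, G (a, b)).
  right; apply: (@card_le_of_rel _ _ B A (fun b a => G (a, b))).
    by move=> b1 /ranG[a1 Gab]; exists a1 => //; have [] := GAB _ Gab.
  by move=> b1 b2 a1 Gab Gab2; exact: (Ginj _ _ Gab Gab2).1.
exfalso; apply: (Gmax (G `|` [set (a, b)])).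
  split; first by move=> p; left.
  by move=> /(_ (a, b)) h; apply: aG; exists b; apply: h; right.
split=> [p [/GAB//|->//]|p q [Gp|->] [Gq|->]] /=; first exact: Ginj.
- split=> [pa|pb].
    by exfalso; apply: aG; exists p.2; rewrite -pa -surjective_pairing.
  by exfalso; apply: bG; exists p.1; rewrite -pb -surjective_pairing.
- split=> [pa|pb].
    by exfalso; apply: aG; exists q.2; rewrite pa -surjective_pairing.
  by exfalso; apply: bG; exists q.1; rewrite pb -surjective_pairing.
- by [].
Qed.

Lemma card_ltP {T U : Type} (A : set T) (B : set U) :
  card_lt A B <-> ~ (B #<= A)%card.
Proof.
split=> [[]//|nBA]; split=> //.
by have [//|/nBA] := card_le_total A B.
Qed.

Lemma card_le_lt_trans {T U V : Type} {A : set T} {B : set U} {C : set V} :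
  (A #<= B)%card -> card_lt B C -> card_lt A C.
Proof.
by move=> AB /card_ltP nCB; apply/card_ltP => /card_le_trans/(_ AB).
Qed.

Lemma finite_card_lt {T U : Type} (A : set T) (B : set U) :
  finite_set A -> infinite_set B -> card_lt A B.
Proof. by move=> Afin Binf; apply/card_ltP => /card_le_finite/(_ Afin). Qed.

(** * Complete filters *)

Lemma complete_bigcap {K S I : Type} {G : set_system S} {D : set I}
    {A : I -> set S} :
    card_complete K G -> card_lt D [set: K] -> (forall i, D i -> G (A i)) ->
  G (\bigcap_(i in D) A i).
Proof.
move=> Gc Dlt GA; have := Gc (A @` D); rewrite bigcap_image; apply.
  by move=> _ [i Di <-]; exact: GA.
exact: card_le_lt_trans (card_image_le _ _) Dlt.
Qed.

Lemma card_le_surj {T U : Type} {A : set T} {B : set U} :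
    (A #<= B)%card -> A !=set0 ->
  exists f : U -> T, (forall b, B b -> A (f b)) /\
    (forall a, A a -> exists2 b, B b & f b = a).
Proof.
move=> /pfcard_geP[->[]//|[f] _]; exists f; split=> [b Bb|a Aa].
  exact: (@funS _ _ _ _ f).
exact: (@surj _ _ _ _ f).
Qed.

Lemma complete_filter {K S : Type} {F : set_system S} :
    infinite_set [set: K] -> card_complete K F ->
    (forall A B, A `<=` B -> F A -> F B) ->
  Filter F.
Proof.
move=> Kinf Fc FS; split=> //.
  rewrite -(bigcap_set0 id); apply: Fc; first exact: sub0set.
  exact: finite_card_lt.
move=> A B FA FB; rewrite -bigcap2inE.
have lt2 : card_lt `I_2 [set: K] by exact: finite_card_lt.
by apply: (complete_bigcap Fc lt2) => -[|[|]].
Qed.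

(** * Regularity of strongly compact cardinals *)

(** The free magma stands in for K itself in counting arguments: the injection
    of pairs given by [Node] is immediate, whereas an injection of K x K into K
    would need a transfinite construction. *)
Inductive magma (K : Type) := Leaf of K | Node of magma K & magma K.

Arguments Leaf {K}.
Arguments Node {K}.

Fixpoint magma_depth {K} (z : magma K) : nat :=
  if z is Node a b then (maxn (magma_depth a) (magma_depth b)).+1 else 0.

(** By induction on n, closure under K-indexed intersections gives closure under
    intersections indexed by the elements of depth at most n: an intersection
    over the nodes is an iterated intersection over their two branches. The
    countably many depths are then indexed by K, which is infinite. *)
Lemma magma_bigcap {K S : Type} {G : set_system S} :
    Filter G -> infinite_set [set: K] ->
    (forall A : K -> set S, (forall x, G (A x)) -> G (\bigcap_x A x)) ->
  forall A : magma K -> set S, (forall z, G (A z)) -> G (\bigcap_z A z).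
Proof.
move=> GF Kinf GK.
have depth n (A : magma K -> set S) : (forall z, G (A z)) ->
    G (\bigcap_(z in [set z | (magma_depth z <= n)%N]) A z).
  elim: n A => [|n IHn] A GA.
    apply: filterS (GK (fun x => A (Leaf x)) (fun x => GA _)) => s As.
    by case=> [x _|a b //]; exact: As.
  have GN := IHn _ (fun a => IHn _ (fun b => GA (Node a b))).
  apply: filterS (filterI (GK (fun x => A (Leaf x)) (fun x => GA _)) GN).
  move=> s [AL AN]; case=> [x _|a b]; first exact: AL.
  by rewrite /= ltnS geq_max => /andP[an bn]; exact: AN.
move=> A GA.
(* g maps K onto the natural numbers, so that it enumerates all depths. *)
have [|g [_ gsurj]] := card_le_surj ((infiniteP _).1 Kinf); first by exists 0.
apply: filterS (GK _ (fun x => depth (g x) A GA)) => s As z _.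
have [x _ gx] := gsurj (magma_depth z) I.
by apply: (As x) => //=; rewrite gx.
Qed.

(** The filter lives on the power set of the free magma Z, and consists of the
    sets whose complement is covered by a map from Z. Cantor's theorem makes it
    proper, and a union of Z-many such complements is again enumerated by Z
    because Z x Z embeds in Z. An ultrafilter closed under K-indexed, hence
    under Z-indexed, intersections is generated by the single subset
    [b = [set z | [set s | s z] \in G]] of Z, whereas the complement of the
    singleton of b belongs to the filter. *)
Lemma exists_filter_without_wide_ultra {K : Type} :
  infinite_set [set: K] ->
  exists (S : Type) (F : set_system S), [/\ ProperFilter F, card_complete K F &
    forall G : set_system S, UltraFilter G -> F `<=` G ->
     ~ (forall A : K -> set S, (forall x, G (A x)) -> G (\bigcap_x A x))].
Proof.
move=> Kinf.
pose Z := magma K; have [x0 _] := infinite_setN0 Kinf.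
exists (set Z); pose F : set_system (set Z) :=
  [set A | exists e : Z -> set Z, ~` A `<=` range e].
exists F.
have Fc : card_complete K F.
  move=> F0 F0F F0lt.
  have F0Z : (F0 #<= [set: Z])%card.
    apply: (card_le_trans F0lt.1).
    apply: (card_le_of_rel _ _ (fun x z => z = Leaf x)).
      by move=> x _; exists (Leaf x).
    by move=> x y z -> [].
  have [->|/set0P F0N0] := eqVneq F0 set0.
    by exists (fun=> setT) => s; rewrite bigcap_set0 setCT.
  have [g [gF0 gsurj]] := card_le_surj F0Z F0N0.
  have /choice[e eP] : forall z, exists e : Z -> set Z, ~` (g z) `<=` range e.
    by move=> z; apply: F0F; exact: gF0.
  (* Leaves enumerate nothing new: their common value is arbitrary. *)
  exists (fun z => if z is Node a b then e a b else setT).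
  move=> s; rewrite setC_bigcap => -[A F0A nAs].
  have [a _ gaA] := gsurj A F0A; rewrite -gaA in nAs.
  by have [b _ ebs] := eP _ _ nAs; exists (Node a b).
have FF : Filter F.
  apply: complete_filter Kinf Fc _ => A B AB [e eA].
  by exists e; apply: subset_trans eA; exact: subsetC.
split=> //.
  apply: Build_ProperFilter => -[e eP].
  (* Cantor's diagonal set is not a value of e. *)
  have [|z _ ezP] := eP [set z | ~ e z z]; first by rewrite setC0.
  have nez : ~ e z z by move=> ez; have := ez; rewrite ezP; apply.
  by apply: (nez); rewrite ezP.
move=> G GU FG GK.
pose b z := G [set s | s z].
have Gb : G [set b].
  apply: filterS (magma_bigcap _ Kinf GK (fun z => [set s | s z <-> b z]) _).
    by move=> s sb; apply/funext => z; apply/propext; exact: sb.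
  move=> z; rewrite /b.
  have [Gz|Gz] := in_ultra_setVsetC [set s : set Z | s z] GU.
    by apply: filterS (Gz) => s /= sz; split.
  apply: filterS (Gz) => s /= nsz; split=> // Gz'.
  by have [? []] := filter_ex (filterI Gz Gz').
have GNb : G (~` [set b]).
  by apply: FG; exists (fun=> b) => s; rewrite setCK => ->; exists (Leaf x0).
by have [? []] := filter_ex (filterI Gb GNb).
Qed.

(** If the union were not small, it would map onto K, and K would be a union of
    fewer than kappa small sets. A K-indexed intersection could then be
    bracketed into fewer than kappa intersections of fewer than kappa sets each,
    so that every kappa-complete ultrafilter would be closed under K-indexed
    intersections; [exists_filter_without_wide_ultra] rules this out. *)
Lemma strongly_compact_regular {K L T : Type} (D : set L) (J : L -> set T) :
    infinite_set [set: K] -> strongly_compact K ->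
    card_lt D [set: K] -> (forall i, D i -> card_lt (J i) [set: K]) ->
  card_lt (\bigcup_(i in D) J i) [set: K].
Proof.
move=> Kinf Ksc Dlt Jlt; apply/card_ltP => KJ.
have [S [F [FP Fc]]] := exists_filter_without_wide_ultra Kinf.
have [G [GU Gc FG]] := Ksc _ _ FP Fc.
move=> /(_ _ GU FG); apply => A GA.
have [f [_ fsurj]] := card_le_surj KJ (infinite_setN0 Kinf).
have GfJ i : D i -> G (\bigcap_(x in f @` J i) A x).
  move=> Di; apply: (complete_bigcap Gc) => [|x _]; last exact: GA.
  exact: card_le_lt_trans (card_image_le _ _) (Jlt _ Di).
apply: filterS (complete_bigcap Gc Dlt GfJ) => s As x _.
by have [t [i Di Jit] <-] := fsurj x I; apply: (As i) => //; exists t.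
Qed.

(** The intersections of fewer than kappa members of B generate a filter; its
    kappa-completeness is where the regularity of kappa enters. *)
Lemma strongly_compact_ultra {K S : Type} (B : set_system S) :
    infinite_set [set: K] -> strongly_compact K ->
    (forall J, J `<=` B -> card_lt J [set: K] -> \bigcap_(A in J) A !=set0) ->
  exists G : set_system S, [/\ UltraFilter G, card_complete K G & B `<=` G].
Proof.
move=> Kinf Ksc Bsip.
pose F : set_system S := [set A | exists J, [/\ J `<=` B,
  card_lt J [set: K] & \bigcap_(C in J) C `<=` A]].
have Fc : card_complete K F.
  move=> F0 F0F F0lt.
  have /choice[J JP] : forall A, exists J, F0 A -> [/\ J `<=` B,
      card_lt J [set: K] & \bigcap_(C in J) C `<=` A].
    move=> A; have [/F0F[J JP]|nF0A] := pselect (F0 A); first by exists J.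
    by exists set0 => /nF0A.
  exists (\bigcup_(A in F0) J A); split.
  - by move=> C [A /JP[JB _ _]]; exact: JB.
  - by apply: strongly_compact_regular => // A /JP[].
  - move=> s Cs A F0A; have [_ _] := JP _ F0A; apply=> C JAC.
    by apply: Cs; exists A.
have FF : Filter F.
  apply: complete_filter Kinf Fc _ => A A' AA' [J [JB Jlt JA]].
  by exists J; split=> //; exact: subset_trans AA'.
have FP : ProperFilter F.
  apply: Build_ProperFilter => -[J [JB Jlt J0]].
  by have [s /J0] := Bsip _ JB Jlt.
have [G [GU Gc FG]] := Ksc _ _ FP Fc.
exists G; split=> // A BA; apply: FG; exists [set A]; split.
- by move=> _ ->.
- exact: finite_card_lt.
- by rewrite bigcap_set1.
Qed.

(** * The space of complete ultrafilters *)

(** A clopen set is the preimage of a point under a continuous map to the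
    discrete space [bool]; pulling back the discrete uniformity of [bool]
    along this map yields a uniformity that separates the two sides. *)
Lemma clopen_uniform_separator {T : topologicalType} (x : T) (C B : set T) :
  clopen C -> C x -> C `&` B = set0 -> uniform_separator [set x] B.
Proof.
move=> [oC cC] Cx CB0.
exists (Uniform.class (initial_topology (fun y : T => y \in C))).
exists [set p | (p.1 \in C) = (p.2 \in C)]; split.
- exists [set p : bool * bool | p.1 = p.2] => //.
  by move=> p [b _ <-].
- rewrite -subset0 => -[y z [[/= -> Bz]]]; rewrite mem_set//.
  move=> /esym/set_mem Cz.
  by have : (C `&` B) z by []; rewrite CB0.
- move=> y N [V [[W oW <-] /= Wy] WN].
  have [Cy|nCy] := pselect (C y).
    apply: (filterS (P := C)); last by apply: open_nbhs_nbhs.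
    by move=> z Cz; apply: WN; rewrite /= mem_set// -(mem_set Cy).
  apply: (filterS (P := ~` C)).
    by move=> z nCz; apply: WN; rewrite /= memNset// -(memNset nCy).
  by apply: open_nbhs_nbhs; split=> //; exact: closed_openC.
Qed.

(** Write kappa for |K|. This is the subspace of the Stone-Cech
    compactification of the discrete space S formed by the kappa-complete
    ultrafilters. *)
Definition kultra (K S : Type) : Type :=
  {G : set_system S | UltraFilter G /\ card_complete K G}.

HB.instance Definition _ (K S : Type) := gen_eqMixin (kultra K S).
HB.instance Definition _ (K S : Type) := gen_choiceMixin (kultra K S).

Definition kultra_mem {K S : Type} (A : set S) : set (kultra K S) :=
  [set u | sval u A].

Section kultra_topology.
Variables K S : Type.

Definition kultra_op : set_system (kultra K S) :=
  [set O | forall u, O u -> exists2 A, kultra_mem A u & kultra_mem A `<=` O].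

Let kultra_opT : kultra_op setT.
Proof.
by move=> u _; have [? _] := svalP u; exists setT => //; exact: filterT.
Qed.

Let kultra_opI : setI_closed kultra_op.
Proof.
move=> O P oO oP u [/oO[A Au AO] /oP[B Bu BP]].
have [? _] := svalP u; exists (A `&` B); first exact: filterI.
move=> v vAB; have [? _] := svalP v.
by split; [apply: AO|apply: BP]; apply: filterS vAB => ? [].
Qed.

Let kultra_op_bigU (J : Type) (f : J -> set (kultra K S)) :
  (forall j, kultra_op (f j)) -> kultra_op (\bigcup_j f j).
Proof.
move=> of_ u [j _ /of_[A Au Af]]; exists A => // v /Af fv.
by exists j.
Qed.

HB.instance Definition _ := isOpenTopological.Build (kultra K S)
  kultra_opT kultra_opI kultra_op_bigU.

Lemma kultra_openE (O : set (kultra K S)) : open O = kultra_op O.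
Proof. by []. Qed.

Lemma kultra_mem_open (A : set S) : open (kultra_mem A : set (kultra K S)).
Proof. by rewrite kultra_openE => u Au; exists A. Qed.

Lemma kultra_nbhsP (u : kultra K S) (O : set (kultra K S)) :
  nbhs u O <-> exists2 A, kultra_mem A u & kultra_mem A `<=` O.
Proof.
rewrite nbhsE; split=> [[P [oP Pu] PO]|[A Au AO]].
  move: oP; rewrite kultra_openE => /(_ _ Pu)[A Au AP].
  by exists A => //; exact: subset_trans PO.
by exists (kultra_mem A) => //; split=> //; exact: kultra_mem_open.
Qed.

Lemma kultra_memC (A : set S) :
  kultra_mem (~` A) = ~` kultra_mem A :> set (kultra K S).
Proof.
apply/seteqP; split=> u /=; have [uU _] := svalP u.
  by move=> uCA uA; have [? []] := filter_ex (filterI uA uCA).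
by have [|//] := in_ultra_setVsetC A uU.
Qed.

Lemma kultra_mem_closed (A : set S) : closed (kultra_mem A : set (kultra K S)).
Proof.
by rewrite -[A]setCK kultra_memC; apply/open_closedC/kultra_mem_open.
Qed.

Lemma kultra_hausdorff : hausdorff_space (kultra K S).
Proof.
move=> [G Gp] [H Hp] uv; apply: eq_exist; have [GU _] := Gp; have [HU _] := Hp.
apply: (max_filter (UltraFilter := HU)) => A HA; apply: contrapT => nGA.
have [||w []] := uv (kultra_mem (~` A)) (kultra_mem A).
- by apply/kultra_nbhsP; exists (~` A); rewrite // kultra_memC.
- by apply/kultra_nbhsP; exists A.
- by rewrite kultra_memC.
Qed.

Lemma kultra_completely_regular : completely_regular_space (kultra K S).
Proof.
move=> u B clB nBu.
have /kultra_nbhsP[A Au AB] : nbhs u (~` B).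
  by apply: open_nbhs_nbhs; split=> //; exact: closed_openC.
apply: (@clopen_uniform_separator _ _ (kultra_mem A)) => //.
  by split; [exact: kultra_mem_open|exact: kultra_mem_closed].
by rewrite -subset0 => v [/AB].
Qed.

End kultra_topology.

(** The subcover is found on S: if J consists of subsets of S, each basic clopen
    set over a member of J lies in some set of the cover, and J covers S with
    fewer than kappa sets, then every kappa-complete ultrafilter contains a
    member of J. *)
Lemma kultra_lindelof (K S : Type) :
    infinite_set [set: K] -> strongly_compact K ->
  card_lindelof K (kultra K S).
Proof.
move=> Kinf Ksc U Uop Ucov.
pose B := [set A : set S | exists2 O, U O & kultra_mem A `<=` O].
have [J [JB Jlt Jcov]] : exists J, [/\ J `<=` B, card_lt J [set: K] &
    \bigcap_(A in J) ~` A = set0].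
  apply: contrapT => nJ.
  have [|G [GU Gc BG]] := strongly_compact_ultra (setC @` B) Kinf Ksc.
    move=> J JB Jlt; apply/set0P/eqP => J0; apply: nJ.
    exists (setC @` J); split.
    - by move=> _ [_ /JB[A BA <-] <-]; rewrite setCK.
    - exact: card_le_lt_trans (card_image_le _ _) Jlt.
    - rewrite bigcap_image -J0; apply: eq_bigcapr => A _.
      by rewrite setCK.
  pose u : kultra K S := exist _ G (conj GU Gc).
  have [P UP Pu] : (\bigcup_(A in U) A) u by rewrite Ucov.
  have [A Au AP] := Uop _ UP _ Pu.
  apply: (@filter_not_empty _ G _).
  rewrite -(setICr A); apply: filterI => //; apply: BG; exists A => //.
  by exists P.
have /choice[W WP] : forall A, exists P, J A -> U P /\ kultra_mem A `<=` P.
  move=> A; have [/JB[P UP AP]|nJA] := pselect (J A); first by exists P.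
  by exists set0 => /nJA.
exists (W @` J); split.
- by move=> _ [A /WP[UW _] <-].
- apply/seteqP; split=> // u _; apply: contrapT => nu.
  have [uU uc] := svalP u.
  apply: (@filter_not_empty _ (sval u) _).
  rewrite -Jcov; apply: (complete_bigcap uc) => // A JA.
  suff : (~` kultra_mem A) u by rewrite -kultra_memC.
  move=> Au; apply: nu; exists (W A); first by exists A.
  by have [_] := WP _ JA; exact.
- exact: card_le_lt_trans (card_image_le _ _) Jlt.
Qed.

(** * Extension of maps *)

Lemma ultra_fmap {T U : Type} (f : T -> U) (G : set_system T) :
  UltraFilter G -> UltraFilter (f @ G).
Proof.
move=> GU; split=> [|H HP GH]; first exact: fmap_proper_filter.
apply/seteqP; split=> // A HA.
have [//|GA] := in_ultra_setVsetC (f @^-1` A) GU.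
by have [? []] := filter_ex (filterI HA (GH (~` A) GA)).
Qed.

Lemma complete_fmap {K T U : Type} (f : T -> U) (G : set_system T) :
  card_complete K G -> card_complete K (f @ G).
Proof.
move=> Gc F0 F0G F0lt; rewrite /fmap /= preimage_bigcap.
exact: (complete_bigcap Gc).
Qed.

(** If G had no limit, the open sets outside G would cover Y; the complements of
    a subcover of size less than kappa all belong to G but have an empty
    intersection. *)
Lemma lindelof_ultra_cvg {K : Type} {Y : topologicalType} (G : set_system Y) :
  card_lindelof K Y -> UltraFilter G -> card_complete K G ->
  exists y : Y, G --> y.
Proof.
move=> YL GU Gc; apply: contrapT => /forallNP ncvg.
have [||V [VU Vcov Vlt]] := YL [set O | open O /\ ~ G O].
- by move=> O [].
- apply/seteqP; split=> // y _; have /existsNP[N /not_implyP[]] := ncvg y.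
  rewrite nbhsE => -[P [oP Py] PN] nGN; exists P => //; split=> // GP.
  by apply: nGN; exact: filterS GP.
apply: (@filter_not_empty _ G _).
rewrite -setCT -Vcov setC_bigcup.
apply: (complete_bigcap Gc) => // O /VU[_ nGO].
by have [|//] := in_ultra_setVsetC O GU.
Qed.

(** The separating uniformity induces a coarser regular topology, in which
    closures are larger; a neighbourhood found there serves in T as well. *)
Lemma uniformly_separated_regular {T : topologicalType} :
  completely_regular_space T -> @regular_space T.
Proof.
move=> Tcr x O xO.
have [P [oP Px] PO] : exists2 P, open_nbhs x P & P `<=` O.
  by move: xO; rewrite nbhsE.
have [||uT [E [entE xE0 nbhsUT]]] := Tcr x (~` P).
- exact: open_closedC.
- by move=> /(_ Px).
pose UT : uniformType := Uniform.Pack uT.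
have Ex : nbhs (x : UT) (xsection E x) by exact: nbhs_entourage.
have [N Nx NE] := @uniform_regular UT x _ Ex.
exists N; first exact: nbhsUT.
move=> y yN; apply: PO; apply: contrapT => nPy.
have /xsectionP Exy : xsection E x y.
  by apply: NE => B /nbhsUT/yN.
by have : ([set x] `*` ~` P `&` E) (x, y) by []; rewrite xE0.
Qed.

Lemma principal_complete (K : Type) {S : Type} (x : S) :
  card_complete K (principal_filter x).
Proof.
move=> F0 F0x _; apply/principal_filterP => A /F0x.
by move/principal_filterP.
Qed.

Definition kultra_principal (K : Type) {S : Type} (x : S) : kultra K S :=
  exist _ (principal_filter x)
    (conj (principal_filter_ultra x) (principal_complete K x)).

Lemma kultra_principal_dense {K S : Type} {Y : topologicalType}
    (g h : kultra K S -> Y) :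
    hausdorff_space Y -> continuous g -> continuous h ->
    g \o kultra_principal K = h \o kultra_principal K ->
  g = h.
Proof.
move=> Yh gc hc gh; apply/funext => u; apply: Yh => A B /gc gA /hc hB.
have /kultra_nbhsP[C Cu CAB] : nbhs u (g @^-1` A `&` h @^-1` B).
  exact: filterI.
have [uU _] := svalP u; have [x Cx] := filter_ex Cu.
have [gAx hBx] : (g @^-1` A `&` h @^-1` B) (kultra_principal K x).
  by apply: CAB; apply/principal_filterP.
exists (g (kultra_principal K x)); split=> //.
by have := congr1 (fun k => k x) gh => /= ->.
Qed.

(** The extension g sends u to a limit of f(u). Given a neighbourhood O of g u,
    regularity provides a neighbourhood N of g u with closure inside O; the
    ultrafilters containing the preimage of N form a neighbourhood of u, which
    g maps into the closure of N. *)
Lemma kultra_extension {K S : Type} {Y : topologicalType} (f : S -> Y) :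
    tychonoff_space Y -> card_lindelof K Y ->
  exists g : kultra K S -> Y, continuous g /\ f = g \o kultra_principal K.
Proof.
move=> [Ycr Yh] YL.
have /choice[g gP] : forall u : kultra K S, exists y : Y, f @ sval u --> y.
  move=> u; have [uU uc] := svalP u.
  exact: lindelof_ultra_cvg YL (ultra_fmap f _ uU) (complete_fmap f _ uc).
exists g; split.
  move=> u O /(uniformly_separated_regular Ycr)[N Nu NO].
  apply/kultra_nbhsP; exists (f @^-1` N); first exact: (gP u).
  move=> v Nv; apply: NO => B vB; have [vU _] := svalP v.
  have [x [Nx Bx]] := filter_ex (filterI Nv (gP v _ vB)).
  by exists (f x).
apply/funext => x; apply: Yh => A B xA xB.
exists (f x); split; first exact: nbhs_singleton.
by have /principal_filterP := gP (kultra_principal K x) _ xB.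
Qed.

(* The cardinal |X| is infinite, as is implicit in the notion of a strongly
   compact cardinal; for |X| = 0, 1 or 3 the conclusion fails. *)
Theorem corollary4p12 (X : discreteTopologicalType)
    (X_infinite : infinite_set [set: X]) (X_sc : strongly_compact X) :
  has_functorial_lindelofification X X.
Proof.
exists (kultra X X), (kultra_principal X); split.
- split; [exact: kultra_completely_regular|exact: kultra_hausdorff].
- exact: kultra_lindelof.
- move=> x A /nbhs_singleton Ax; rewrite nbhs_principalE.
  by apply/principal_filterP.
- move=> Y f YT YL _; have [g [gc fg]] := kultra_extension f YT YL.
  exists g; split=> // h [hc fh].
  by apply: (kultra_principal_dense g h) => //; [case: YT|rewrite -fg].
Qed.
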